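(* Let $N\ge 1$, let $\Omega\subseteq\mathbb{R}^N$ be a nonempty (possibly unbounded) open set and let $2<p<2+\frac4N$. Assume: (A1) an action ground state exists in $\mathcal{N}_\lambda$ for every $\lambda>-\lambda_\Omega$, and an energy ground state exists in $\mathcal{M}_\mu$ for every $\mu>0$; (A2) for every pair of sequences $\lambda_n>-\lambda_\Omega$ and $\mu_n\in Q(\lambda_n)$ such that $\lambda_n\to\lambda\in(-\lambda_\Omega,+\infty)$ and $\mu_n\to\mu\in\mathbb{R}$, there holds $\mu\in\overline{Q(\lambda)}$, the closure of $Q(\lambda)$. Then: (i) the left and right derivatives $\mathcal{J}'_-(\lambda)$, $\mathcal{J}'_+(\lambda)$ of $\mathcal{J}$ exist for every $\lambda\in(-\lambda_\Omega,+\infty)$, and $$\mathcal{J}_-'(\lambda)=\sup Q(\lambda),\qquad \mathcal{J}_+'(\lambda)=\inf Q(\lambda);$$ (ii) there exists an at most countable set $Z\subset(-\lambda_\Omega,+\infty)$ such that, for every $\lambda\in(-\lambda_\Omega,+\infty)\setminus Z$, the set $Q(\lambda)=\{\mu_\lambda\}$ is a singleton. In particular, $\mathcal{J}$ is differentiable in $(-\lambda_\Omega,+\infty)\setminus Z$, where $\mathcal{J}'(\lambda)=\mu_\lambda$.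
   Context: $\|\cdot\|_q$ is the norm of $L^q(\Omega)$; functions are real-valued. For $\lambda\in\mathbb{R}$ and $u\in H_0^1(\Omega)$, the action functional is $J_\lambda(u)=\frac12\|\nabla u\|_2^2+\frac\lambda2\|u\|_2^2-\frac1p\|u\|_p^p$ and the energy functional is $E(u)=\frac12\|\nabla u\|_2^2-\frac1p\|u\|_p^p$. The Nehari manifold is $\mathcal{N}_\lambda=\{u\in H_0^1(\Omega)\setminus\{0\}:\ \|\nabla u\|_2^2+\lambda\|u\|_2^2=\|u\|_p^p\}$. The mass-constrained space is $\mathcal{M}_\mu=\{u\in H_0^1(\Omega):\ \frac12\|u\|_2^2=\mu\}$. The levels are $\mathcal{J}(\lambda)=\inf_{v\in\mathcal{N}_\lambda}J_\lambda(v)$ and $\mathcal{E}(\mu)=\inf_{v\in\mathcal{M}_\mu}E(v)$. A function $u\in\mathcal{N}_\lambda$ is an action ground state if $J_\lambda(u)=\mathcal{J}(\lambda)$; a function $u\in\mathcal{M}_\mu$ is an energy ground state if $E(u)=\mathcal{E}(\mu)$. The bottom of the spectrum of the Dirichlet Laplacian is $\lambda_\Omega=\inf_{u\in H_0^1(\Omega)\setminus\{0\}}\|\nabla u\|_2^2/\|u\|_2^2$. For $\lambda>-\lambda_\Omega$, $Q(\lambda)$ is the set of all $\mu\in\mathbb{R}$ for which there exists an action ground state $u\in\mathcal{N}_\lambda$ with $\frac12\|u\|_2^2=\mu$. *)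

(* Defs.v *)
From HB Require Import structures.
From mathcomp Require Import all_boot all_order all_algebra.
From mathcomp Require Import all_classical all_reals all_analysis.

Set Implicit Arguments.
Unset Strict Implicit.
Unset Printing Implicit Defensive.

Import Order.TTheory GRing.Theory Num.Theory.
Import numFieldNormedType.Exports.

Local Open Scope classical_set_scope.
Local Open Scope ring_scope.

(* The product sigma-algebra (which is also the Borel one) on R^n. *)
Section measurable_rV.
Context (R : realType) (n : nat).

Let coord (i : 'I_n) (x : 'rV[R]_n) : measurableTypeR R := x ord0 i.

Let rV_set0 : g_sigma_preimage coord set0.
Proof. exact: sigma_algebra0. Qed.

Let rV_setC A : g_sigma_preimage coord A -> g_sigma_preimage coord (~` A).
Proof. exact: sigma_algebraC. Qed.

Let rV_bigcup (F : (set _)^nat) : (forall i, g_sigma_preimage coord (F i)) ->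
  g_sigma_preimage coord (\bigcup_i F i).
Proof. exact: sigma_algebra_bigcup. Qed.

Definition rV_display : measure_display.
Proof. exact: default_measure_display. Qed.

HB.instance Definition _ := @isMeasurable.Build rV_display
  'rV[R]_n (g_sigma_preimage coord) rV_set0 rV_setC rV_bigcup.

Lemma measurable_coord (i : 'I_n) :
  measurable_fun [set: 'rV[R]_n] (fun x => x ord0 i : measurableTypeR R).
Proof.
move=> _ Y mY; rewrite setTI; apply: sub_sigma_algebra => /=.
rewrite -bigcup_seq/=; exists i => /=; first by rewrite mem_index_enum.
by exists Y => //; rewrite setTI.
Qed.

Lemma measurable_fun_rV d (T : measurableType d) (f : T -> 'rV[R]_n) :
  (forall i, measurable_fun [set: T] (fun x => f x ord0 i : measurableTypeR R)) ->
  measurable_fun [set: T] f.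
Proof.
move=> mf.
suff pre : g_sigma_preimage (fun i => coord i \o f) `<=` measurable.
  move=> _ A mA; apply: pre; rewrite g_sigma_preimage_comp.
  by exists A.
apply: smallest_sub; first exact: sigma_algebra_measurable.
rewrite -bigcup_seq/=; apply: bigcup_sub => i _ A [B mB <-]; exact: mf.
Qed.

End measurable_rV.

Section lebesgue_rV.
Context (R : realType).
Local Open Scope ereal_scope.

Definition cons_rV n (p : measurableTypeR R * 'rV[R]_n) : 'rV[R]_n.+1 :=
  row_mx (const_mx p.1 : 'rV[R]_1) p.2.

Definition uncons_rV n (x : 'rV[R]_n.+1) : measurableTypeR R * 'rV[R]_n :=
  (x ord0 ord0, \row_j x ord0 (lift ord0 j)).

Lemma cons_rVK n : cancel (@cons_rV n) (@uncons_rV n).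
Proof.
case=> a v; rewrite /uncons_rV /cons_rV /=; congr (_, _).
  by rewrite (_ : ord0 = @lshift 1 n ord0) ?(@row_mxEl R 1 1 n) ?mxE//;
    exact: val_inj.
apply/rowP => j; rewrite mxE.
rewrite (_ : lift ord0 j = @rshift 1 n j) ?(@row_mxEr R 1 1 n)//.
exact: val_inj.
Qed.

Lemma measurable_cons_rV n : measurable_fun setT (@cons_rV n).
Proof.
apply: measurable_fun_rV => i; case: (unliftP ord0 i) => [j ->|->].
- apply: eq_measurable_fun (measurableT_comp (measurable_coord j)
    (@measurable_snd _ _ _ _)) => p _ /=.
  by rewrite -{1}(cons_rVK p) /= mxE.
- apply: eq_measurable_fun (@measurable_fst _ _ _ _) => p _.
  by rewrite -{1}(cons_rVK p).
Qed.

Lemma measurable_uncons_rV n : measurable_fun setT (@uncons_rV n).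
Proof.
apply/measurable_fun_pairP; split; first exact: measurable_coord.
apply: measurable_fun_rV => i.
apply: eq_measurable_fun (measurable_coord (lift ord0 i)) => x _.
by rewrite /= mxE.
Qed.

HB.instance Definition _ n :=
  isMeasurableFun.Build _ _ _ _ (@cons_rV n) (@measurable_cons_rV n).

Section step.
Context (n : nat) (m : {sigma_finite_measure set 'rV[R]_n -> \bar R}).

Definition lebesgue_cons : set 'rV[R]_n.+1 -> \bar R :=
  pushforward (lebesgue_measure \x m) (@cons_rV n).

Let cons0 : lebesgue_cons set0 = 0.
Proof. exact: measure0. Qed.

Let cons_ge0 A : 0 <= lebesgue_cons A.
Proof. exact: measure_ge0. Qed.

Let cons_sigma_additive : semi_sigma_additive lebesgue_cons.
Proof. exact: measure_semi_sigma_additive. Qed.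

HB.instance Definition _ := isMeasure.Build _ _ _ lebesgue_cons
  cons0 cons_ge0 cons_sigma_additive.

Let cons_sigma_finite : sigma_finite setT lebesgue_cons.
Proof.
have /sigma_finiteP[F [TF ndF Foo]] := sigma_finiteT (@lebesgue_measure R).
have /sigma_finiteP[G [TG ndG Goo]] := sigma_finiteT m.
have cover : \bigcup_k (F k `*` G k) = setT.
  rewrite -setXTT TF TG predeqE => -[x y]; split.
    by move=> [k _ []/= ? ?]; split; exists k.
  move=> [/= [k _ Fx] [l _ Gy]]; exists (maxn k l) => //; split.
  - by move: x Fx; exact/subsetPset/ndF/leq_maxl.
  - by move: y Gy; exact/subsetPset/ndG/leq_maxr.
exists (fun k => @uncons_rV n @^-1` (F k `*` G k)).
  by rewrite -preimage_bigcup cover preimage_setT.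
move=> k; have [mF Fk] := Foo k; have [mG Gk] := Goo k.
have mFG : measurable (F k `*` G k) by exact: measurableX.
split.
  by rewrite -[X in measurable X]setTI; exact: measurable_uncons_rV.
rewrite /lebesgue_cons /pushforward -comp_preimage.
rewrite (_ : _ \o _ = id); last by apply/funext => p; rewrite /= cons_rVK.
rewrite preimage_id product_measure1E// lte_mul_pinfty//.
by rewrite ge0_fin_numE.
Qed.

HB.instance Definition _ := Measure_isSigmaFinite.Build _ _ _ lebesgue_cons
  cons_sigma_finite.
End step.

(* n-dimensional Lebesgue measure, as the n-fold product of the one-dimensional
   one; see lebesgue_rV_box. *)
Fixpoint lebesgue_rV n : {sigma_finite_measure set 'rV[R]_n -> \bar R} :=
  if n is k.+1 then lebesgue_cons (lebesgue_rV k)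
  else dirac (0%R : 'rV[R]_0).

Lemma lebesgue_rV_box n (A : 'I_n -> set R) :
  (forall i, measurable (A i : set (measurableTypeR R))) ->
  lebesgue_rV n [set x | forall i, A i (x ord0 i)] =
  \prod_(i < n) lebesgue_measure (A i).
Proof.
elim: n A => [|n IH] A mA.
  rewrite big_ord0 /= diracE mem_set//=; by case.
rewrite big_ord_recl /= /lebesgue_cons /pushforward.
have -> : @cons_rV n @^-1` [set x | forall i, A i (x ord0 i)] =
    A ord0 `*` [set x : 'rV[R]_n | forall i, A (lift ord0 i) (x ord0 i)].
  rewrite predeqE => p; rewrite -{2}(cons_rVK p); split=> /=.
    by move=> Ap; split => [//|i]; rewrite mxE.
  move=> [A0 Ap] i; case: (unliftP ord0 i) => [j ->|->//].
  by move: (Ap j); rewrite mxE.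
rewrite product_measure1E//; first by congr (_ * _); exact: IH.
rewrite (_ : mkset _ = \bigcap_(i in [set: 'I_n])
    ((fun x : 'rV[R]_n => x ord0 i) @^-1` A (lift ord0 i))); last first.
  by rewrite predeqE => x; split=> [+ i _|+ i]; [exact|move=> /(_ i); exact].
apply: fin_bigcap_measurable => // i _; rewrite -[X in measurable X]setTI.
exact: (measurable_coord i).
Qed.

End lebesgue_rV.

Section sobolev.
Context (R : realType) (N : nat) (Omega : set 'rV[R]_N).

Local Notation V := 'rV[R]_N.
Local Notation leb := (lebesgue_rV R N).

Definition partial (i : 'I_N) (f : V -> R) : V -> R :=
  'D_(delta_mx ord0 i : V) f.

Definition gradient (f : V -> R) (x : V) : V := \row_i partial i f x.

Definition smooth (f : V -> R) : Prop :=
  forall s : seq 'I_N, let g := foldr partial f s in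
    continuous g /\ forall i x, derivable g x (delta_mx ord0 i : V).

Definition support (f : V -> R) : set V := closure [set x | f x != 0].

Definition test_function (phi : V -> R) : Prop :=
  [/\ smooth phi, compact (support phi) & support phi `<=` Omega].

Definition enorm (v : V) : R := Num.sqrt (\sum_i v ord0 i ^+ 2).

Definition eLq_norm (q : R) (f : V -> R) : \bar R :=
  'N[leb]_(q%:E)[EFin \o (f \_ Omega)].

Definition Lq_norm (q : R) (f : V -> R) : R := fine (eLq_norm q f).

Definition square_integrable (f : V -> R) : Prop :=
  f \_ Omega \in Lfun leb 2%:E.

Definition weak_gradient (u : V -> R) (du : V -> V) : Prop :=
  forall (phi : V -> R) (i : 'I_N), test_function phi ->
    (\int[leb]_(x in Omega) (u x * partial i phi x) =
      - \int[leb]_(x in Omega) (du x ord0 i * phi x))%R.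

(* The closure of the test functions in H^1(Omega).  An element is stored as the
   pair (u, du) of a function and its weak gradient; since weak gradients are
   unique up to a null set, such a pair carries the same information as u. *)
Definition H10 : set ((V -> R) * (V -> V)) :=
  [set w : (V -> R) * (V -> V) |
  [/\ square_integrable w.1,
      forall i, square_integrable (fun x => w.2 x ord0 i),
      weak_gradient w.1 w.2 &
      exists phi : nat -> V -> R,
        [/\ forall n, test_function (phi n),
            eLq_norm 2 (fun x => phi n x - w.1 x) @[n --> \oo] --> 0%E &
            eLq_norm 2 (fun x => enorm (gradient (phi n) x - w.2 x))
              @[n --> \oo] --> 0%E]]].

Implicit Type w : (V -> R) * (V -> V).

Definition nonzero w : Prop :=
  ~ (\forall x \ae leb, Omega x -> w.1 x = 0).

Definition norm_fun w (q : R) : R := Lq_norm q w.1.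

Definition norm_grad w : R := Lq_norm 2 (fun x => enorm (w.2 x)).

Definition lambda_bottom : R :=
  inf [set norm_grad w ^+ 2 / norm_fun w 2 ^+ 2 | w in H10 `&` nonzero].

Section functionals.
(* For 2 < p < 2 + 4/N, Sobolev's inequality makes the L^p norm of an element of
   H10 finite, and Gagliardo-Nirenberg's makes the energy bounded below on each
   mass_constrained m; the action is nonnegative on nehari lam as soon as
   - lambda_bottom < lam.  So fine and inf never take their default values in
   these cases. *)
Context (p : R).

Definition action (lam : R) w : R :=
  2^-1 * norm_grad w ^+ 2 + lam / 2 * norm_fun w 2 ^+ 2
  - p^-1 * norm_fun w p `^ p.

Definition energy w : R :=
  2^-1 * norm_grad w ^+ 2 - p^-1 * norm_fun w p `^ p.

Definition mass w : R := 2^-1 * norm_fun w 2 ^+ 2.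

Definition nehari (lam : R) : set ((V -> R) * (V -> V)) :=
  [set w : (V -> R) * (V -> V) |
  [/\ H10 w, nonzero w &
      norm_grad w ^+ 2 + lam * norm_fun w 2 ^+ 2 = norm_fun w p `^ p]].

Definition mass_constrained (m : R) : set ((V -> R) * (V -> V)) :=
  [set w | H10 w /\ mass w = m].

Definition action_level (lam : R) : R := inf (action lam @` nehari lam).

Definition energy_level (m : R) : R := inf (energy @` mass_constrained m).

Definition action_ground_state (lam : R) w : Prop :=
  nehari lam w /\ action lam w = action_level lam.

Definition energy_ground_state (m : R) w : Prop :=
  mass_constrained m w /\ energy w = energy_level m.

Definition ground_masses (lam : R) : set R :=
  [set mass w | w in action_ground_state lam].

End functionals.
End sobolev.

Definition has_left_derivative (R : realType) (f : R -> R) (x l : R) : Prop :=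
  h^-1 * (f (x + h) - f x) @[h --> 0^'-] --> l.

Definition has_right_derivative (R : realType) (f : R -> R) (x l : R) : Prop :=
  h^-1 * (f (x + h) - f x) @[h --> 0^'+] --> l.

(* Main.v *)
Require Import Defs.
From mathcomp Require Import all_boot all_order all_algebra.
From mathcomp Require Import all_classical all_reals all_analysis.
From mathcomp Require Import measurable_realfun ring lra.
Import Order.TTheory GRing.Theory Num.Theory.
Import numFieldNormedType.Exports.
Local Open Scope classical_set_scope.
Local Open Scope ring_scope.

Set Implicit Arguments.
Unset Strict Implicit.
Unset Printing Implicit Defensive.

(** Write J for the action level, Q(lam) for the set of masses of action ground
    states, e = p / (p - 2) and kappa = 1/2 - 1/p.  On the Nehari manifold the
    action equals kappa ||u||_p^p.  Put P = ||u||_p^p.  Every nonzero u of H10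
    with P > 0 can be rescaled onto the manifold of any lam > - lambda_bottom,
    and the action of the rescaled function is
      kappa ((||grad u||_2^2 + lam ||u||_2^2) P^(1/e - 1))^e.
    Hence g = (J / kappa)^(1/e) is an infimum of functions that are affine in
    lam, so it is concave.  A ground state u at lam realizes the infimum there,
    and its affine function has slope ||u||_2^2 P^(1/e - 1) = c(lam) m, where
    m is the mass of u and c(lam) = 2 g(lam)^(1 - e).  So each element of
    c(lam) Q(lam) is a supergradient of g at lam
    ([ground_slopes_supergradients]).

    The rest is one-dimensional convex analysis.  Supergradients decrease with
    the base point, so those at x + 1/n form a monotone sequence bounded above
    by every supergradient at x; if the selected supergradients have a closed
    graph, the limit lies in the closure of those selected at x, which forces
    it to be their infimum, and squeezing the difference quotient gives the
    right derivative ([right_derivative_supergradient]).  The left derivative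
    follows by the reflection x |-> - x.  Two selected sets meet at most at an
    endpoint, so only countably many of them are not singletons
    ([countable_gap]).

    Finally J = kappa g^e, and the derivative of y |-> kappa y^e at g(lam) is
    1 / c(lam): the chain rule turns c(lam) sup Q(lam) and c(lam) inf Q(lam)
    into sup Q(lam) and inf Q(lam).

    Rescaling rests on the homogeneity of integrals under positive factors,
    which is proved for arbitrary functions, measurable or not, and with
    infinite values allowed; this covers the p-th power norms and the
    approximating gradients at once. *)

(** * Positive homogeneity of integrals, norms and the Sobolev space *)

(** The integral of a nonnegative function is a supremum of integrals of simple
    functions below it, and scaling permutes these simple functions.  Arguing on
    the supremum makes the lemma cover nonmeasurable functions. *)
Lemma ge0_integral_scale_le {d} {T : measurableType d} {R : realType}
    (mu : {measure set T -> \bar R}) (D : set T) (f : T -> \bar R) (t : R) :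
  0 < t -> (forall x, (0 <= f x)%E) ->
  (t%:E * \int[mu]_(x in D) f x <= \int[mu]_(x in D) (t%:E * f x))%E.
Proof.
move=> t0 f0; have t0' : (0 < t%:E)%E by rewrite lte_fin.
rewrite muleC -lee_pdivlMr// ge0_integralE//.
rewrite ge0_integralE; last by move=> x _; apply: mule_ge0 => //; exact: ltW.
apply: ge_ereal_sup => _ [h hf <-].
rewrite lee_pdivlMr// muleC -sintegralrM.
apply: ereal_sup_ubound; exists (scale_nnsfun h (ltW t0)) => //= x.
rewrite EFinM; have := hf x; rewrite /patch; case: ifP => _ hx.
  by rewrite lee_pmul2l.
by apply: mule_ge0_le0 => //; exact: ltW.
Qed.

Lemma ge0_integral_scale {d} {T : measurableType d} {R : realType}
    (mu : {measure set T -> \bar R}) (D : set T) (f : T -> \bar R) (t : R) :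
  0 < t -> (forall x, (0 <= f x)%E) ->
  (\int[mu]_(x in D) (t%:E * f x) = t%:E * \int[mu]_(x in D) f x)%E.
Proof.
move=> t0 f0; apply/eqP; rewrite eq_le ge0_integral_scale_le// andbT.
have ti0 : 0 < t^-1 by rewrite invr_gt0.
rewrite -(@lee_pmul2l _ (t^-1)%:E)//.
apply: le_trans (ge0_integral_scale_le mu D ti0 _) _ => /=.
  by move=> x; apply: mule_ge0 => //; exact: ltW.
under eq_integral => x _ do
  rewrite muleA -EFinM mulVf ?mul1e ?gt_eqF//.
by rewrite muleA -EFinM mulVf ?mul1e ?gt_eqF.
Qed.

(** For a nonintegrable function, an infinite positive or negative part stays
    infinite after scaling, and [fine] then gives zero on both sides. *)
Lemma Rintegral_scale {d} {T : measurableType d} {R : realType}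
    (mu : {measure set T -> \bar R}) (D : set T) (f : T -> R) (t : R) :
  0 < t -> (\int[mu]_(x in D) (t * f x) = t * \int[mu]_(x in D) f x)%R.
Proof.
move=> t0; rewrite /Rintegral integralE [in RHS]integralE.
have t0' : (0 <= t%:E)%E by rewrite lee_fin ltW.
have -> : ((fun x => (t * f x)%:E)^\+ = fun x => t%:E * (EFin \o f)^\+ x)%E.
  by rewrite -ge0_funeposM ?ltW.
have -> : ((fun x => (t * f x)%:E)^\- = fun x => t%:E * (EFin \o f)^\- x)%E.
  by rewrite -ge0_funenegM ?ltW.
rewrite !ge0_integral_scale//.
have : (0 <= \int[mu]_(x in D) (EFin \o f)^\+ x)%E by exact: integral_ge0.
have : (0 <= \int[mu]_(x in D) (EFin \o f)^\- x)%E by exact: integral_ge0.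
case: (integral _ _ _) => [a| |]//; case: (integral _ _ _) => [b| |]// _ _ /=.
- by rewrite mulrBr.
- by rewrite gt0_muley ?lte_fin// mulr0.
- by rewrite gt0_muley ?lte_fin// mulr0.
- by rewrite gt0_muley ?lte_fin// mulr0.
Qed.

Lemma Lnorm_scale {d} {T : measurableType d} {R : realType}
    (mu : {measure set T -> \bar R}) (f : T -> R) (t q : R) :
  0 < t -> q != 0 ->
  (Lnorm mu q%:E (fun x => (t * f x)%:E) =
   t%:E * Lnorm mu q%:E (EFin \o f))%E.
Proof.
move=> t0 q0; have t0' : (0 <= t%:E)%E by rewrite lee_fin ltW.
rewrite unlock /Lnorm.
under eq_integral => x _ do rewrite EFinM abseM gee0_abs// poweRM// poweR_EFin.
rewrite ge0_integral_scale ?powR_gt0//; last by move=> x; exact: poweR_ge0.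
rewrite -poweR_EFin poweRM ?poweR_ge0//; last first.
  by apply: integral_ge0 => x _; exact: poweR_ge0.
by rewrite -poweRrM mulfV// poweRe1.
Qed.

Section scaling.
Context (R : realType) (N : nat) (Omega : set 'rV[R]_N).
Local Notation V := 'rV[R]_N.

Definition scale_pair (t : R) (w : (V -> R) * (V -> V)) :
    (V -> R) * (V -> V) :=
  (fun x => t * w.1 x, fun x => t *: w.2 x).

Lemma eLq_norm_scale (q t : R) (f : V -> R) : 0 < t -> q != 0 ->
  eLq_norm Omega q (fun x => t * f x) = (t%:E * eLq_norm Omega q f)%E.
Proof.
move=> t0 q0; rewrite /eLq_norm -Lnorm_scale//; congr Lnorm.
by apply/funext => x /=; rewrite /patch; case: ifP => //; rewrite mulr0.
Qed.

Lemma Lq_norm_scale (q t : R) (f : V -> R) : 0 < t -> q != 0 ->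
  Lq_norm Omega q (fun x => t * f x) = t * Lq_norm Omega q f.
Proof.
move=> t0 q0; rewrite /Lq_norm eLq_norm_scale//.
case: (eLq_norm _ _ _) => [a| |]//=.
  by rewrite gt0_muley ?lte_fin// mulr0.
by rewrite gt0_muleNy ?lte_fin// mulr0.
Qed.

Lemma enormZ (t : R) (v : V) : 0 < t -> enorm (t *: v) = t * enorm v.
Proof.
move=> t0; rewrite /enorm.
under eq_bigr => i _ do rewrite mxE exprMn.
by rewrite -mulr_sumr sqrtrM ?sqr_ge0// sqrtr_sqr gtr0_norm.
Qed.

Lemma norm_fun_scale (q t : R) w : 0 < t -> q != 0 ->
  norm_fun Omega (scale_pair t w) q = t * norm_fun Omega w q.
Proof. exact: Lq_norm_scale. Qed.

Lemma norm_grad_scale (t : R) w : 0 < t ->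
  norm_grad Omega (scale_pair t w) = t * norm_grad Omega w.
Proof.
move=> t0; rewrite /norm_grad -Lq_norm_scale//; congr Lq_norm.
by apply/funext => x /=; rewrite enormZ.
Qed.

(** Smoothness is needed because a derivative commutes with a scalar factor only
    where it exists. *)
Lemma foldr_partial_scale (t : R) (f : V -> R) (s : seq 'I_N) : smooth f ->
  foldr (@partial R N) (fun x => t * f x) s =
  (fun x => t * foldr (@partial R N) f s x).
Proof.
move=> sf; elim: s => [//|i s /= ->].
by apply/funext => x; have [_ df] := sf s; exact: deriveZ.
Qed.

Lemma test_function_scale (t : R) (phi : V -> R) : 0 < t ->
  test_function Omega phi -> test_function Omega (fun x => t * phi x).
Proof.
move=> t0 [sphi cphi Ophi]; rewrite /test_function.
have -> : Defs.support (fun x => t * phi x) = Defs.support phi.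
  rewrite /Defs.support; congr closure; apply/seteqP; split => x /=.
    by rewrite mulf_eq0 negb_or => /andP[].
  by rewrite mulf_eq0 negb_or (gt_eqF t0).
split => // s /=.
rewrite foldr_partial_scale//; have [cf df] := sphi s; split.
  by move=> x; apply: (cvgM (cvg_cst t) (cf x)).
by move=> i x; apply: derivableZ.
Qed.

Lemma H10_scale (t : R) w : 0 < t -> H10 Omega w -> H10 Omega (scale_pair t w).
Proof.
move=> t0; case: w => u du [/= su sdu wu [phi [tphi cu cdu]]]; split => /=.
- rewrite /square_integrable.
  rewrite (_ : _ \_ _ = t \o* (u \_ Omega)).
    by apply: Lfun_scale => //; rewrite ler1n.
  by apply/funext => x /=; rewrite /patch; case: ifP => _; rewrite ?mul0r// mulrC.
- move=> i; rewrite /square_integrable.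
  rewrite (_ : _ \_ _ = t \o* ((fun x => du x ord0 i) \_ Omega)).
    by apply: Lfun_scale => //; [rewrite ler1n|exact: sdu].
  apply/funext => x /=; rewrite /patch; case: ifP => _; rewrite ?mul0r//.
  by rewrite mxE mulrC.
- move=> f i tf /=; rewrite /weak_gradient in wu.
  transitivity (t * \int[lebesgue_rV R N]_(x in Omega) (u x * partial i f x))%R.
    by rewrite -Rintegral_scale//; apply: eq_Rintegral => x _; rewrite mulrA.
  rewrite wu// mulrN -Rintegral_scale//; congr (- _).
  by apply: eq_Rintegral => x _; rewrite mxE mulrA.
- exists (fun n x => t * phi n x); split.
  + by move=> n; exact: test_function_scale.
  + have : (t%:E * eLq_norm Omega 2 (fun x => phi n x - u x)%R)%E
      @[n --> \oo] --> (t%:E * 0)%E by exact: cvgeZl.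
    rewrite mule0; apply: cvg_trans; apply: near_eq_cvg; apply: nearW => n.
    rewrite -eLq_norm_scale//; congr eLq_norm.
    by apply/funext => x; rewrite mulrBr.
  + have : (t%:E * eLq_norm Omega 2 (fun x => enorm (gradient (phi n) x - du x))%R)%E
      @[n --> \oo] --> (t%:E * 0)%E by exact: cvgeZl.
    rewrite mule0; apply: cvg_trans; apply: near_eq_cvg; apply: nearW => n.
    rewrite -eLq_norm_scale//; congr eLq_norm.
    apply/funext => x; rewrite -enormZ//; congr enorm; rewrite scalerBr.
    congr (_ - _); apply/rowP => i; rewrite !mxE.
    by have [s _ _] := tphi n; have /= := foldr_partial_scale t [:: i] s => ->.
Qed.

Lemma nonzero_scale (t : R) w : 0 < t -> nonzero Omega w ->
  nonzero Omega (scale_pair t w).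
Proof.
move=> t0 nz h; apply: nz; apply: filterS h => x h Ox.
by have /eqP := h Ox; rewrite /= mulf_eq0 gt_eqF//= => /eqP.
Qed.

Lemma norm_fun_ge0 w q : 0 <= norm_fun Omega w q.
Proof. by apply: fine_ge0; exact: Lnorm_ge0. Qed.

(** Square integrability is what excludes the case of an infinite norm, which
    [fine] would turn into zero. *)
Lemma norm_fun2_gt0 w : H10 Omega w -> nonzero Omega w ->
  0 < norm_fun Omega w 2.
Proof.
move=> [+ _ _ _] nz; rewrite lt0r norm_fun_ge0 andbT /square_integrable.
rewrite inE => /andP[/[!inE] /= mu fu]; apply: contra_notN nz => /eqP n0.
have : eLq_norm Omega 2 w.1 = 0%E.
  move: n0 fu; rewrite /norm_fun /Lq_norm /finite_norm /eLq_norm.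
  have := Lnorm_ge0 (lebesgue_rV R N) 2%:E (EFin \o w.1 \_ Omega).
  by case: (Lnorm _ _ _) => //= a _ ->.
move=> /Lnorm_eq0_eq0; rewrite lte_fin ltr0n => /(_ _ isT) h.
have {h} := h ((measurable_EFinP _ _).2 mu).
apply: filterS => x /(_ I) /= [+] Ox; rewrite /patch mem_set//.
Qed.

Lemma poincare w : H10 Omega w -> nonzero Omega w ->
  lambda_bottom Omega * norm_fun Omega w 2 ^+ 2 <= norm_grad Omega w ^+ 2.
Proof.
move=> Hw nw; have n0 := norm_fun2_gt0 Hw nw.
rewrite -ler_pdivlMr ?exprn_gt0//; apply: ge_inf; last by exists w.
exists 0 => _ [v _ <-]; by rewrite divr_ge0 ?sqr_ge0.
Qed.

End scaling.

(** * One-sided derivatives from a closed family of supergradients *)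

(** [S x] is only some set of supergradients of [g] at [x]; nonemptiness of all
    of them already makes [g] concave on convex parts of [I]. *)
Definition supergradients {R : realType} (I : set R) (g : R -> R)
    (S : R -> set R) : Prop :=
  (forall x, I x -> S x !=set0) /\
  (forall x y s, I x -> I y -> S x s -> g y <= g x + (y - x) * s).

(** Limits are only asked to be in the closure of [S x]: this is enough to
    identify the infimum and the supremum of [S x]. *)
Definition closed_graph_on {R : realType} (I : set R) (S : R -> set R) : Prop :=
  forall (x_ s_ : nat -> R) x s,
    (forall n, I (x_ n)) -> (forall n, S (x_ n) (s_ n)) -> I x ->
    x_ n @[n --> \oo] --> x -> s_ n @[n --> \oo] --> s ->
    closure (S x) s.

Section supergradient.
Context (R : realType) (I : set R) (g : R -> R) (S : R -> set R).
Hypotheses (Iopen : open I) (gS : supergradients I g S).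

Lemma slope_le x y s : I x -> I y -> x < y -> S x s ->
  (y - x)^-1 * (g y - g x) <= s.
Proof.
move=> Ix Iy xy Ss; have := gS.2 _ _ _ Ix Iy Ss.
by rewrite ler_pdivrMl ?subr_gt0// lerBlDl.
Qed.

Lemma le_slope x y t : I x -> I y -> x < y -> S y t ->
  t <= (y - x)^-1 * (g y - g x).
Proof.
move=> Ix Iy xy St; have := gS.2 _ _ _ Iy Ix St.
rewrite ler_pdivlMl ?subr_gt0//; lra.
Qed.

(** Both supergradients are compared with the slope of the chord. *)
Lemma supergradient_le x y s t : I x -> I y -> x < y -> S x s -> S y t -> t <= s.
Proof.
by move=> Ix Iy xy Ss St; exact: le_trans (le_slope Ix Iy xy St) (slope_le Ix Iy xy Ss).
Qed.

Lemma open_ball x : I x ->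
  exists2 e, 0 < e & forall y, `|x - y| < e -> I y.
Proof.
move=> Ix; have /nbhs_ballP[e e0 eI] := open_nbhs_nbhs (conj Iopen Ix).
by exists e => // y xy; exact: eI.
Qed.

(** Any supergradient at a point to the right of [x] is a lower bound. *)
Lemma has_inf_supergradient x : I x -> has_inf (S x).
Proof.
move=> Ix; split; first exact: gS.1.
have [e e0 eI] := open_ball Ix.
have Iy : I (x + e / 2) by apply: eI; rewrite opprD addNKr normrN gtr0_norm; lra.
have [t St] := gS.1 _ Iy; exists t => s Ss.
by apply: (supergradient_le Ix Iy _ Ss St); lra.
Qed.

(** Around [x] the supergradients lie between those at two fixed points on
    either side, so [g] is Lipschitz near [x]. *)
Lemma supergradient_continuous x : I x -> g y @[y --> x] --> g x.
Proof.
move=> Ix; have [e e0 eI] := open_ball Ix.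
have Ia : I (x - e / 2) by apply: eI; rewrite opprB addrC subrK gtr0_norm; lra.
have Ib : I (x + e / 2) by apply: eI; rewrite opprD addNKr normrN gtr0_norm; lra.
have [a Sa] := gS.1 _ Ia; have [b Sb] := gS.1 _ Ib; have [s Ss] := gS.1 _ Ix.
pose K := `|a| + `|b| + `|s| + 1.
have K0 : 0 < K by rewrite ltr_wpDl// !addr_ge0.
apply/cvgrPdist_le => eps eps0; near=> y.
have yx : `|x - y| < e / 2.
  by near: y; apply: cvgr_dist_lt => //; lra.
have Iy : I y by apply: eI; lra.
have [t St] := gS.1 _ Iy.
have ta : t <= a.
  by apply: (supergradient_le Ia Iy _ Sa St); move: yx; rewrite ltr_norml; lra.
have bt : b <= t.
  by apply: (supergradient_le Iy Ib _ St Sb); move: yx; rewrite ltr_norml; lra.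
have gyx : g y - g x <= `|x - y| * K.
  have := gS.2 _ _ _ Ix Iy Ss; rewrite -lerBlDl => /le_trans; apply.
  rewrite (le_trans (ler_norm _))// normrM distrC ler_wpM2l//.
  by rewrite /K; have := normr_ge0 a; have := normr_ge0 b; lra.
have gxy : g x - g y <= `|x - y| * K.
  have := gS.2 _ _ _ Iy Ix St; rewrite -lerBlDl => /le_trans; apply.
  rewrite (le_trans (ler_norm _))// normrM ler_wpM2l//.
  rewrite ler_norml /K.
  have := ler_norm a; have := ler_norm (- b); rewrite normrN.
  by have := normr_ge0 a; have := normr_ge0 b; have := normr_ge0 s; lra.
have : `|x - y| < eps / K by near: y; apply: cvgr_dist_lt => //; exact: divr_gt0.
rewrite ltr_pdivlMr// => xyK.
by rewrite ler_norml; apply/andP; split; lra.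
Unshelve. all: by end_near. Qed.

(** The difference quotient at [x + h] is at most every element of [S x] and at
    least every supergradient at a point beyond [x + h].  Supergradients
    selected along a sequence decreasing to [x] increase to a limit, which the
    closed graph identifies as [inf (S x)]. *)
Lemma right_derivative_supergradient x : closed_graph_on I S -> I x ->
  has_right_derivative g x (inf (S x)).
Proof.
move=> Scl Ix; have [e e0 eI] := open_ball Ix.
(* Dividing by n + 2 keeps every point strictly within distance e of x. *)
pose x_ n := x + e * n.+2%:R^-1.
have dx_gt0 n : 0 < e * n.+2%:R^-1 :> R by rewrite mulr_gt0 ?invr_gt0.
have dx_lt n : e * n.+2%:R^-1 < e.
  by rewrite gtr_pMr// invf_lt1 ?ltr1n.
have Ix_ n : I (x_ n).
  by apply: eI; rewrite opprD addNKr normrN gtr0_norm.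
have /choice[s_ Ss_] : forall n, exists s, S (x_ n) s by move=> n; exact: gS.1.
have s_nd : nondecreasing_seq s_.
  apply/nondecreasing_seqP => n.
  apply: (supergradient_le (Ix_ n.+1) (Ix_ n)) => //.
  by rewrite /x_ ltrD2l ltr_pM2l// ltf_pV2 ?posrE// ltr_nat.
have s_ub n s : S x s -> s_ n <= s.
  by move=> Ss; apply: (supergradient_le Ix (Ix_ n) _ Ss) => //; rewrite ltrDl.
have [s0 Ss0] := gS.1 _ Ix.
have s_cvg : s_ n @[n --> \oo] --> sup (range s_).
  by apply: nondecreasing_cvgn => //; exists s0 => _ [n _ <-]; exact: s_ub.
have x_cvg : x_ n @[n --> \oo] --> x.
  rewrite -[X in _ --> X]addr0 -(mulr0 e); apply: cvgD; first exact: cvg_cst.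
  apply: cvgM; first exact: cvg_cst.
  by have := @cvg_harmonic R; rewrite -(cvg_shiftn 1); under eq_fun do rewrite addn1.
have supE : sup (range s_) = inf (S x).
  apply/eqP; rewrite eq_le; apply/andP; split.
    apply: ge_sup; first by exists (s_ 0%N), 0%N.
    by move=> _ [n _ <-]; apply: lb_le_inf; [exists s0|move=> s; exact: s_ub].
  have /closure_id : closed [set t | inf (S x) <= t] by exact: closed_ge.
  move=> clE; suff : closure [set t | inf (S x) <= t] (sup (range s_)) by rewrite -clE.
  apply: closure_subset (Scl _ _ _ _ Ix_ Ss_ Ix x_cvg s_cvg) => s Ss.
  by apply: ge_inf => //; exact: (has_inf_supergradient Ix).2.
(* From here on, s_ n within eps of inf (S x) squeezes the quotient for all
   h below x_ n - x. *)
rewrite supE in s_cvg.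
apply/cvgrPdist_le => eps eps0.
have [n _ /(_ n (leqnn n)) sn] := (cvgrPdist_le _ _).1 s_cvg _ eps0.
near=> h.
have h0 : 0 < h by near: h; exact: nbhs_right_gt.
have hn : h < e * n.+2%:R^-1 by near: h; exact: nbhs_right_lt.
have Ih : I (x + h).
  by apply: eI; rewrite opprD addNKr normrN gtr0_norm//; have := dx_lt n; lra.
have hE : h = (x + h) - x by rewrite addrC addKr.
have [t St] := gS.1 _ Ih.
have q_le : h^-1 * (g (x + h) - g x) <= inf (S x).
  apply: lb_le_inf; first by exists s0.
  by move=> s Ss; rewrite {1}hE; apply: slope_le => //; rewrite ltrDl.
have q_ge : s_ n <= h^-1 * (g (x + h) - g x).
  apply: le_trans (_ : t <= _); last first.
    by rewrite {1}hE; apply: le_slope => //; rewrite ltrDl.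
  by apply: (supergradient_le Ih (Ix_ n) _ St) => //; rewrite /x_ ltrD2l.
move: sn; rewrite !ler_norml => /andP[_ sn]; apply/andP; split; lra.
Unshelve. all: by end_near. Qed.

End supergradient.

Section reflection.
Context (R : realType) (I : set R) (g : R -> R) (S : R -> set R).

Lemma openN_preimage : open I -> open (-%R @^-1` I).
Proof. by apply: open_comp => x _; exact: opp_continuous. Qed.

Lemma supergradientsN : supergradients I g S ->
  supergradients (-%R @^-1` I) (g \o -%R) (fun x => -%R @` S (- x)).
Proof.
move=> [S0 Sg]; split=> [x Ix|x y _ Ix Iy [s Ss <-]] /=.
  by have [s Ss] := S0 _ Ix; exists (- s), s.
by have := Sg _ _ _ Ix Iy Ss; lra.
Qed.

Lemma closureN (A : set R) s : closure A (- s) -> closure (-%R @` A) s.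
Proof.
move=> cA B Bs; have [|y [Ay By]] := cA (-%R @^-1` B).
  by rewrite nbhsN; apply: filterS Bs => y By /=; rewrite opprK.
by exists (- y); split => //; exists y.
Qed.

Lemma closed_graph_onN : closed_graph_on I S ->
  closed_graph_on (-%R @^-1` I) (fun x => -%R @` S (- x)).
Proof.
move=> Scl x_ s_ x s Ix_ Ss_ Ix cx cs; apply: closureN.
apply: (Scl (fun n => - x_ n) (fun n => - s_ n)) => //.
- by move=> n; have [t St <-] := Ss_ n; rewrite opprK.
- exact: cvgN.
- exact: cvgN.
Qed.

Hypotheses (Iopen : open I) (gS : supergradients I g S).

Lemma has_sup_supergradient x : I x -> has_sup (S x).
Proof.
move=> Ix; have := has_inf_supergradient (openN_preimage Iopen) (supergradientsN gS).
move=> /(_ (- x)); rewrite /= opprK => /(_ Ix) /has_inf_supN.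
by rewrite image_comp /= ; under eq_imagel do rewrite /= opprK; rewrite image_id.
Qed.

Lemma left_derivative_supergradient x : closed_graph_on I S -> I x ->
  has_left_derivative g x (sup (S x)).
Proof.
move=> Scl Ix; apply/cvg_at_leftNP; rewrite oppr0.
have := @right_derivative_supergradient _ _ _ _ (openN_preimage Iopen)
  (supergradientsN gS) (- x) (closed_graph_onN Scl).
rewrite /= opprK => /(_ Ix) /cvgN; rewrite /inf !opprK image_comp.
rewrite (_ : (-%R \o -%R) @` S x = S x); last first.
  by under eq_imagel do rewrite /= opprK; rewrite image_id.
apply: cvg_trans; apply: near_eq_cvg; apply: nearW => h /=.
rewrite [LHS](_ : _ = - (h^-1 * (g (- (- x + h)) - g (- - x))))//.
by rewrite opprK opprD opprK invrN mulNr.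
Qed.

(** The intervals from [inf (S x)] to [sup (S x)] are ordered, hence disjoint,
    and a rational number picked in each nondegenerate one determines [x]. *)
Lemma countable_gap : countable [set x | I x /\ inf (S x) < sup (S x)].
Proof.
have /choice[q qP] : forall x, exists q : rat,
    inf (S x) < sup (S x) -> inf (S x) < ratr q < sup (S x).
  move=> x; have [/rat_in_itvoo[q]|ge] := ltP (inf (S x)) (sup (S x)).
    by rewrite in_itv /= => hq; exists q.
  by exists 0.
have q_mono x y : I x -> I y -> x < y -> inf (S x) < sup (S x) ->
    inf (S y) < sup (S y) -> q y < q x.
  move=> Ix Iy xy /qP/andP[xq _] /qP/andP[_ yq].
  rewrite -(ltr_rat R) (lt_le_trans yq)// (le_trans _ (ltW xq))//.
  apply: ge_sup => [|t St]; first exact: gS.1.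
  apply: lb_le_inf => [|s Ss]; first exact: gS.1.
  exact: (supergradient_le gS Ix Iy xy Ss St).
apply/countable_injP; exists (pickle \o q) => x y.
rewrite !inE /= => -[Ix gx] [Iy gy] /(pcan_inj pickleK) qxy.
apply/eqP; rewrite eq_le; apply/andP; split; rewrite leNgt; apply/negP => xy.
  by have := q_mono _ _ Iy Ix xy gy gx; rewrite qxy ltxx.
by have := q_mono _ _ Ix Iy xy gx gy; rewrite qxy ltxx.
Qed.

End reflection.

(** A chain rule for difference quotients along any filter at 0, so that it
    covers one-sided derivatives.  The slope function [psi] of [phi], extended
    at 0 by the derivative, avoids dividing by [g (x + h) - g x], which may
    vanish. *)
Lemma cvg_quotient_comp {R : realType} (F : set_system R) {FF : Filter F}
    (g phi : R -> R) (x l d : R) :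
  h @[h --> F] --> (0 : R) -> (\forall h \near F, h != 0) ->
  is_derive (g x) 1 phi d ->
  h^-1 * (g (x + h) - g x) @[h --> F] --> l ->
  h^-1 * (phi (g (x + h)) - phi (g x)) @[h --> F] --> d * l.
Proof.
move=> F0 Fn0 dphi qg.
pose psi k := if k == 0 then d else k^-1 * (phi (g x + k) - phi (g x)).
have psi0 : psi k @[k --> (0 : R)] --> psi 0.
  apply/continuous_withinNx; rewrite {2}/psi eqxx.
  have dp : (k^-1 *: (phi (k *: 1 + g x) - phi (g x))) @[k --> (0:R)^'] --> d.
    have [dv <-] := dphi; exact: dv.
  apply: cvg_trans dp; apply: near_eq_cvg; near=> k.
  have k0 : k != 0 by near: k; exact: nbhs_dnbhs_neq.
  by rewrite /psi (negbTE k0) /= [k *: 1]mulr1 [g x + k]addrC.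
have k0 : g (x + h) - g x @[h --> F] --> (0 : R).
  rewrite -(mul0r l); apply: cvg_trans (cvgM F0 qg); apply: near_eq_cvg.
  near=> h; have h0 : h != 0 by near: h.
  by rewrite /= mulrA mulfV// mul1r.
have : psi (g (x + h) - g x) * (h^-1 * (g (x + h) - g x)) @[h --> F] --> psi 0 * l.
  exact: (cvgM (cvg_comp _ _ k0 psi0) qg).
rewrite {2}/psi eqxx; apply: cvg_trans; apply: near_eq_cvg; near=> h.
rewrite /psi; case: eqP => [e|/eqP n0].
  by rewrite e (_ : g (x + h) = g x) ?subrr ?mulr0//; apply/eqP; rewrite -subr_eq0 e.
by rewrite (addrC (g x)) subrK mulrCA (mulrAC _^-1) mulVf ?mul1r.
Unshelve. all: by end_near. Qed.

(** * Scaling of sets of reals and of powers *)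

Lemma sup_scale {R : realType} (A : set R) (c : R) : 0 < c -> has_sup A ->
  sup ( *%R c @` A) = c * sup A.
Proof.
move=> c0 [A0 Aub]; have [a Aa] := A0.
have cA0 : *%R c @` A !=set0 by exists (c * a), a.
have cAub : ubound ( *%R c @` A) (c * sup A).
  by move=> _ [x Ax <-]; rewrite ler_pM2l//; exact: ub_le_sup.
apply/eqP; rewrite eq_le ge_sup//= mulrC -ler_pdivlMr//.
apply: ge_sup => // x Ax; rewrite ler_pdivlMr// mulrC.
by apply: ub_le_sup; [exists (c * sup A)|exists x].
Qed.

Lemma inf_scale {R : realType} (A : set R) (c : R) : 0 < c -> has_inf A ->
  inf ( *%R c @` A) = c * inf A.
Proof.
move=> c0 /has_inf_supN iA; rewrite /inf mulrN -sup_scale//; congr (- sup _).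
rewrite !image_comp; apply: eq_imagel => x _ /=; exact: esym (mulrN _ _).
Qed.

Lemma has_sup_scale {R : realType} (A : set R) (c : R) : 0 < c ->
  has_sup ( *%R c @` A) -> has_sup A.
Proof.
move=> c0 [[_ [a Aa _]] [u uA]]; split; first by exists a.
exists (u / c) => x Ax; rewrite ler_pdivlMr// mulrC; apply: uA; exact: imageP.
Qed.

Lemma has_inf_scale {R : realType} (A : set R) (c : R) : 0 < c ->
  has_inf ( *%R c @` A) -> has_inf A.
Proof.
move=> c0 [[_ [a Aa _]] [u uA]]; split; first by exists a.
exists (u / c) => x Ax; rewrite ler_pdivrMr// mulrC; apply: uA; exact: imageP.
Qed.

Lemma closure_scale {R : realType} (A : set R) (c s : R) : 0 < c ->
  closure A (c^-1 * s) -> closure ( *%R c @` A) s.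
Proof.
move=> c0 cA B Bs; have [|y [Ay By]] := cA ( *%R c @^-1` B).
  apply: (@mulrl_continuous _ c); rewrite /= mulrA mulfV ?gt_eqF// mul1r.
  exact: Bs.
by exists (c * y); split => //; exists y.
Qed.

Lemma powR_divr {R : realType} (a b r : R) : 0 < a -> 0 < b ->
  (a / b) `^ r = a `^ r * b `^ (- r).
Proof.
move=> a0 b0; rewrite powRM ?invr_ge0 ?ltW//.
by rewrite -(powR_inv1 (ltW b0)) -powRrM mulN1r.
Qed.

(** * Concavity of the rescaled action level *)

Section nehari.
Context (R : realType) (N : nat) (Omega : set 'rV[R]_N) (p : R).
Hypothesis p_gt2 : 2 < p.
Local Notation V := 'rV[R]_N.
Implicit Type w : (V -> R) * (V -> V).

Local Notation I := [set lam : R | - lambda_bottom Omega < lam].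
Local Notation J := (action_level Omega p).

(* Up to the factor kappa, the level is the e-th power of a concave function
   of lam; kappa is the ratio of action to the p-th power of the norm
   on the Nehari manifold. *)
Let e : R := p / (p - 2).
Let kappa : R := 2^-1 - p^-1.

Let p_gt0 : 0 < p.
Proof. exact: lt_trans p_gt2. Qed.

Let kappa_gt0 : 0 < kappa.
Proof.
by rewrite subr_gt0 ltf_pV2 ?posrE.
Qed.

Let e_gt0 : 0 < e.
Proof. by rewrite divr_gt0 ?subr_gt0// (lt_trans _ p_gt2). Qed.

(** The restriction [- lambda_bottom Omega < lam] is exactly what makes the
    quadratic form of the action positive. *)
Lemma quadratic_gt0 lam w : I lam -> H10 Omega w -> nonzero Omega w ->
  0 < norm_grad Omega w ^+ 2 + lam * norm_fun Omega w 2 ^+ 2.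
Proof.
move=> Il Hw nw; have h := poincare Hw nw.
have n0 : 0 < norm_fun Omega w 2 ^+ 2 by rewrite exprn_gt0// norm_fun2_gt0.
have : 0 < (lam + lambda_bottom Omega) * norm_fun Omega w 2 ^+ 2.
  by rewrite mulr_gt0//; move: Il => /=; lra.
by rewrite mulrDl; lra.
Qed.

Lemma action_nehari lam w : nehari Omega p lam w ->
  action Omega p lam w = kappa * norm_fun Omega w p `^ p.
Proof. by move=> [_ _ hP]; rewrite /action /kappa mulrBl -hP; lra. Qed.

(** The action is nonnegative on the Nehari manifold, so the infimum is
    a genuine lower bound. *)
Lemma action_level_le lam w : nehari Omega p lam w ->
  J lam <= kappa * norm_fun Omega w p `^ p.
Proof.
move=> nw; rewrite -(action_nehari nw); apply: ge_inf; last by exists w.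
exists 0 => _ [v /action_nehari -> <-].
by rewrite mulr_ge0 ?powR_ge0// ltW.
Qed.

(** The scaling that puts [w] on the Nehari manifold is [t] with
    [t ^ (p - 2) = D / P], [D] being the quadratic form and [P] the p-th power
    of the norm.  For fixed [w] the bound is the e-th power of an affine
    function of [lam], which is the source of concavity. *)
Lemma nehari_projection lam w : I lam -> H10 Omega w -> nonzero Omega w ->
  0 < norm_fun Omega w p `^ p ->
  J lam <= kappa * ((norm_grad Omega w ^+ 2 + lam * norm_fun Omega w 2 ^+ 2) *
                    (norm_fun Omega w p `^ p) `^ (e^-1 - 1)) `^ e.
Proof.
move=> Il Hw nw P0; set P := _ `^ p; have D0 := quadratic_gt0 Il Hw nw.
set D := _ + _ in D0 *.
pose t := (D / P) `^ (p - 2)^-1.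
have t0 : 0 < t by rewrite powR_gt0// divr_gt0.
have tp : t `^ p * P = t ^+ 2 * D.
  rewrite -[in LHS](subrKC 2 p) powRD; last by rewrite (gt_eqF t0) implybT.
  rewrite powR_mulrn ?ltW// -mulrA; congr (_ * _).
  have p20 : p - 2 != 0 by rewrite subr_eq0 gt_eqF.
  by rewrite /t -powRrM mulVf// powRr1 ?divfK ?(gt_eqF P0)// ltW// divr_gt0.
have pn : norm_fun Omega (scale_pair t w) p `^ p = t `^ p * P.
  rewrite norm_fun_scale ?(gt_eqF p_gt0)//.
  by rewrite powRM ?norm_fun_ge0 ?ltW.
have tw : nehari Omega p lam (scale_pair t w).
  split; [exact: H10_scale|exact: nonzero_scale|].
  rewrite pn tp norm_grad_scale// norm_fun_scale// /D; ring.
have := action_level_le tw; rewrite pn => /le_trans; apply.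
rewrite ler_pM2l//.
suff -> : t `^ p = D `^ e * P `^ - e.
  rewrite powRM ?powR_ge0 ?(ltW D0)// -powRrM mulrBl mulVf ?gt_eqF// mul1r.
  rewrite -mulrA [1 - e]addrC powRD ?(powRr1 (ltW P0))//.
  by rewrite (gt_eqF P0) implybT.
by rewrite /t -powRrM (mulrC _ p) -/e powR_divr.
Qed.

Lemma ground_state_level lam w : I lam -> action_ground_state Omega p lam w ->
  0 < norm_fun Omega w p `^ p /\ J lam = kappa * norm_fun Omega w p `^ p.
Proof.
move=> Il [nw <-]; rewrite (action_nehari nw); split=> //.
by case: nw => Hw nz <-; exact: quadratic_gt0.
Qed.

(** The exponent [e^-1] undoes the power in [nehari_projection]. *)
Definition concave_level lam : R := (kappa^-1 * J lam) `^ e^-1.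

(** The inverse of the derivative of [y |-> kappa * y ^ e] at
    [concave_level lam]; the factor 2 is [(kappa * e)^-1]. *)
Definition slope_factor lam : R := 2 * concave_level lam `^ (1 - e).

Definition ground_slopes lam : set R :=
  *%R (slope_factor lam) @` ground_masses Omega p lam.

Hypothesis A1 : forall lam, I lam -> exists w, action_ground_state Omega p lam w.

Lemma action_level_gt0 lam : I lam -> 0 < J lam.
Proof.
by move=> Il; have [w /(ground_state_level Il)[P0 ->]] := A1 Il; rewrite mulr_gt0.
Qed.

Lemma concave_level_gt0 lam : I lam -> 0 < concave_level lam.
Proof.
by move=> /action_level_gt0 J0; rewrite powR_gt0// mulr_gt0// invr_gt0.
Qed.

Lemma slope_factor_gt0 lam : I lam -> 0 < slope_factor lam.
Proof. by move=> /concave_level_gt0 g0; rewrite mulr_gt0// powR_gt0. Qed.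

Lemma concave_levelK lam : I lam -> J lam = kappa * concave_level lam `^ e.
Proof.
move=> /action_level_gt0 J0.
rewrite /concave_level -powRrM mulVf ?gt_eqF// powRr1 ?mulrA ?mulfV ?mul1r ?gt_eqF//.
by rewrite mulr_ge0 ?invr_ge0 ?ltW.
Qed.

(** Project a ground state at [x] onto the Nehari manifold at [y]: the resulting
    bound on [concave_level y] is affine in [y], is an equality at [y = x], and
    has the announced slope. *)
Lemma ground_slopes_supergradients : supergradients I concave_level ground_slopes.
Proof.
split=> [lam Il|x y s Ix Iy].
  have [w gw] := A1 Il.
  by exists (slope_factor lam * mass Omega w), (mass Omega w) => //; exists w.
move=> [_ [w gw <-] <-]; have [P0 JE] := ground_state_level Ix gw.
have [[Hw nw hP] _] := gw.
have := nehari_projection Iy Hw nw P0.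
rewrite /slope_factor.
have -> : concave_level x = (norm_fun Omega w p `^ p) `^ e^-1.
  by rewrite /concave_level JE mulrA mulVf ?mul1r ?gt_eqF.
set P := _ `^ p in P0 hP *; set D := _ + y * _.
have D0 : 0 < D by exact: quadratic_gt0.
have -> : (P `^ e^-1) `^ (1 - e) = P `^ (e^-1 - 1).
  by rewrite -powRrM mulrBr mulr1 mulVf ?gt_eqF.
move=> JD.
have : concave_level y <= D * P `^ (e^-1 - 1).
  have : 0 <= D * P `^ (e^-1 - 1) by rewrite mulr_ge0 ?powR_ge0// ltW.
  move: JD; set X := D * _ => JX X0.
  have -> : X = (X `^ e) `^ e^-1 by rewrite -powRrM mulfV ?gt_eqF// powRr1.
  apply: ge0_ler_powR; rewrite ?nnegrE ?powR_ge0//.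
  - by rewrite invr_ge0 ltW.
  - by rewrite ltW// mulr_gt0 ?invr_gt0// action_level_gt0.
  - by rewrite ler_pdivrMl.
move=> /le_trans; apply.
have PE : P `^ e^-1 = P * P `^ (e^-1 - 1).
  by rewrite -{2}(powRr1 (ltW P0)) -powRD ?subrKC// (gt_eqF P0) implybT.
rewrite {}PE /D /mass; set q := P `^ _; rewrite -hP.
move: q (norm_grad _ _ ^+ 2) (norm_fun _ _ 2 ^+ 2) => q a m.
rewrite le_eqVlt; apply/orP; left; apply/eqP.
by field.
Qed.

Hypothesis A2 : forall (lam_ m_ : nat -> R) (lam m : R),
  (forall n, I (lam_ n)) ->
  (forall n, ground_masses Omega p (lam_ n) (m_ n)) ->
  I lam -> lam_ n @[n --> \oo] --> lam -> m_ n @[n --> \oo] --> m ->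
  closure (ground_masses Omega p lam) m.

Lemma open_above_bottom : open I.
Proof. exact: open_gt. Qed.

Lemma slope_factor_continuous lam : I lam ->
  slope_factor x @[x --> lam] --> slope_factor lam.
Proof.
move=> Il; apply: cvgM; first exact: cvg_cst.
have gc := supergradient_continuous open_above_bottom ground_slopes_supergradients Il.
have [dp _] := is_derive1_powR (1 - e) (concave_level_gt0 Il).
have pc : {for concave_level lam, continuous (fun x : R => x `^ (1 - e))}.
  by apply: differentiable_continuous; exact/derivable1_diffP.
exact: (cvg_comp _ _ gc pc).
Qed.

(** [A2] transported through multiplication by [slope_factor], which is
    possible because that factor is continuous and positive. *)
Lemma ground_slopes_closed : closed_graph_on I ground_slopes.
Proof.
move=> x_ s_ x s Ix_ Ss_ Ix cx cs; have c0 := slope_factor_gt0 Ix.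
have cc : slope_factor (x_ n) @[n --> \oo] --> slope_factor x.
  exact: (cvg_comp _ _ cx (slope_factor_continuous Ix)).
have cVs : (slope_factor (x_ n))^-1 * s_ n @[n --> \oo] -->
    (slope_factor x)^-1 * s.
  by apply: cvgM cs; apply: cvgV cc; rewrite gt_eqF.
apply: (closure_scale c0); apply: (A2 Ix_ _ Ix cx cVs) => n.
have [m Qm <-] := Ss_ n; have cn0 := slope_factor_gt0 (Ix_ n).
by rewrite (mulKf (lt0r_neq0 cn0)).
Qed.

Lemma action_level_quotient (F : set_system R) {FF : Filter F} lam l :
  I lam -> h @[h --> F] --> (0 : R) -> (\forall h \near F, h != 0) ->
  h^-1 * (concave_level (lam + h) - concave_level lam) @[h --> F] -->
    slope_factor lam * l ->
  h^-1 * (J (lam + h) - J lam) @[h --> F] --> l.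
Proof.
move=> Il F0 Fn0 gl; have g0 := concave_level_gt0 Il.
have dphi : is_derive (concave_level lam) 1 (fun x => kappa * x `^ e)
    (kappa * (e * concave_level lam `^ (e - 1))).
  by apply: is_deriveZ; exact: is_derive1_powR.
have := cvg_quotient_comp F0 Fn0 dphi gl.
have -> : kappa * (e * concave_level lam `^ (e - 1)) * (slope_factor lam * l) = l.
  rewrite /slope_factor -(opprB e 1) powRN.
  have g1 : concave_level lam `^ (e - 1) != 0 by rewrite gt_eqF// powR_gt0.
  have ke : kappa * e * 2 = 1.
    have p0 : p != 0 by rewrite gt_eqF.
    have p2 : p - 2 != 0 by rewrite subr_eq0 gt_eqF.
    by rewrite /kappa /e; field; rewrite p0 p2.
  transitivity (kappa * e * 2 * l); last by rewrite ke mul1r.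
  by move: (concave_level lam `^ (e - 1)) (kappa) (e) g1 => y a b y0; field.
move=> /(_ FF); apply: cvg_trans; apply: near_eq_cvg.
have Ih : \forall h \near F, I (lam + h).
  have : lam + h @[h --> F] --> lam.
    by rewrite -[X in _ --> X]addr0; apply: cvgD => //; exact: cvg_cst.
  by apply; apply: open_nbhs_nbhs; split => //; exact: open_above_bottom.
apply: filterS Ih => h Ih.
by rewrite (concave_levelK Ih) (concave_levelK Il).
Qed.

Lemma one_sided_derivatives lam : I lam ->
  [/\ has_sup (ground_masses Omega p lam),
      has_left_derivative J lam (sup (ground_masses Omega p lam)),
      has_inf (ground_masses Omega p lam) &
      has_right_derivative J lam (inf (ground_masses Omega p lam))].
Proof.
move=> Il; have c0 := slope_factor_gt0 Il.
have gS := ground_slopes_supergradients.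
have hs := has_sup_scale c0 (has_sup_supergradient open_above_bottom gS Il).
have hi := has_inf_scale c0 (has_inf_supergradient open_above_bottom gS Il).
have := left_derivative_supergradient open_above_bottom gS ground_slopes_closed Il.
have := right_derivative_supergradient open_above_bottom gS ground_slopes_closed Il.
rewrite inf_scale// sup_scale// => rd ld.
split => //; apply: action_level_quotient => //.
- exact: cvg_at_left_filter.
- by near=> h; rewrite lt_eqF//; near: h; exact: nbhs_left_lt.
- exact: cvg_at_right_filter.
- by near=> h; rewrite gt_eqF//; near: h; exact: nbhs_right_gt.
Unshelve. all: by end_near. Qed.

Lemma ground_masses_singleton_off_countable : exists Z : set R,
  [/\ countable Z, Z `<=` I &
    forall lam, I lam -> ~ Z lam ->
      exists m, ground_masses Omega p lam = [set m] /\ is_derive lam 1 J m].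
Proof.
exists [set lam | I lam /\ inf (ground_slopes lam) < sup (ground_slopes lam)].
split => [|lam []//|lam Il nZ].
  exact: (countable_gap ground_slopes_supergradients).
have c0 := slope_factor_gt0 Il; have [hs ld hi rd] := one_sided_derivatives Il.
set Q := ground_masses Omega p lam in hs ld hi rd *.
have isQ : sup Q <= inf Q.
  rewrite leNgt; apply/negP => isQ; apply: nZ; split => //.
  by rewrite inf_scale// sup_scale// ltr_pM2l.
have Qle m : Q m -> inf Q <= m <= sup Q.
  by move=> Qm; rewrite ge_inf ?ub_le_sup//; [exact: hs.2|exact: hi.2].
have Qeq m : Q m -> m = sup Q.
  by move=> /Qle/andP[im ms]; apply/eqP; rewrite eq_le ms (le_trans isQ).
have iE : inf Q = sup Q.
  have [[m Qm] _] := hs; apply/eqP; rewrite eq_le isQ andbT.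
  by have /andP[/le_trans h /h] := Qle _ Qm.
exists (sup Q); split.
  apply/seteqP; split => [m /Qeq//|_ ->].
  by have [[m Qm] _] := hs; rewrite -(Qeq _ Qm).
rewrite iE in rd.
have dJ : h^-1 *: (J (h *: 1 + lam) - J lam) @[h --> 0^'] --> sup Q.
  have := @cvg_at_right_left_dnbhs R R^o _ _ _ rd ld.
  apply: cvg_trans; apply: near_eq_cvg; apply: nearW => h.
  by rewrite [h *: 1]mulr1 (addrC h).
apply: DeriveDef; last exact/cvg_lim.
by apply/cvg_ex; exists (sup Q).
Qed.

End nehari.

Unset Implicit Arguments.
Set Strict Implicit.
Set Printing Implicit Defensive.

Theorem theorem1p5 (R : realType) (N : nat) (Omega : set 'rV[R]_N) (p : R)
  (N_gt0 : (0 < N)%N)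
  (Omega_open : open Omega) (Omega_neq0 : Omega !=set0)
  (p_gt2 : 2 < p) (p_subcritical : p < 2 + 4 / N%:R)
  (A1_action : forall lam : R, - lambda_bottom Omega < lam ->
     exists w, action_ground_state Omega p lam w)
  (A1_energy : forall m : R, 0 < m ->
     exists w, energy_ground_state Omega p m w)
  (A2 : forall (lam_ m_ : nat -> R) (lam m : R),
     (forall n, - lambda_bottom Omega < lam_ n) ->
     (forall n, ground_masses Omega p (lam_ n) (m_ n)) ->
     - lambda_bottom Omega < lam ->
     lam_ n @[n --> \oo] --> lam ->
     m_ n @[n --> \oo] --> m ->
     closure (ground_masses Omega p lam) m) :
  (forall lam : R, - lambda_bottom Omega < lam ->
     [/\ has_sup (ground_masses Omega p lam),
         has_left_derivative (action_level Omega p) lam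
           (sup (ground_masses Omega p lam)),
         has_inf (ground_masses Omega p lam) &
         has_right_derivative (action_level Omega p) lam
           (inf (ground_masses Omega p lam))]) /\
  (exists Z : set R,
     [/\ countable Z,
         Z `<=` [set lam | - lambda_bottom Omega < lam] &
         forall lam : R, - lambda_bottom Omega < lam -> ~ Z lam ->
           exists m : R, ground_masses Omega p lam = [set m] /\
             is_derive lam 1 (action_level Omega p) m]).
Proof.
split; last exact: (ground_masses_singleton_off_countable p_gt2 A1_action A2).
exact: (one_sided_derivatives p_gt2 A1_action A2).
Qed.
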